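(* Let $\mathbb{K}$ be a field of characteristic $0$ and let $d\geq 2$. Let $\mathfrak{n}$ be a finite-dimensional algebra over $\mathbb{K}$, with bilinear product denoted $[\cdot,\cdot]$, and let $\varphi\colon \mathfrak{n}\times\mathfrak{n}\to\mathbb{K}$ be a bilinear form. The following assertions are equivalent: (i) $(\mathfrak{n},\varphi)$ is a quadratic and reduced $2$-step nilpotent Lie algebra of type $d$. (ii) There exist a basis $\mathcal{B}=\{v_1,\dots,v_d,z_1,\dots,z_d\}$ of $\mathfrak{n}$ and a $d$-quadratic family of matrices $\{A_i=(a^i_{kj})_{k,j}: 1\leq i\leq d\}$ over $\mathbb{K}$ (where $a^i_{kj}$ is the entry of $A_i$ in row $k$ and column $j$) such that $[z_i,\mathfrak{n}]=[\mathfrak{n},z_i]=0$ for all $i$ and $$[v_i,v_j]=\sum_{k=1}^d a^i_{kj}z_k\qquad (1\leq i,j\leq d);$$ moreover, $\varphi$ is hyperbolic and its matrix in the ordered basis $\mathcal{B}$ is $$B_0=\begin{pmatrix}\mathbf{0}_{d\times d}&\mathbf{I}_{d\times d}\\ \mathbf{I}_{d\times d}&\mathbf{0}_{d\times d}\end{pmatrix}.$$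
   Context: All vector spaces are finite-dimensional over a field $\mathbb{K}$ of characteristic $0$. A pair $(\mathfrak{g},\varphi)$ with $\mathfrak{g}$ a Lie algebra is quadratic if $\varphi$ is a symmetric nondegenerate bilinear form on $\mathfrak{g}$ that is invariant: $\varphi([x,y],z)+\varphi(y,[x,z])=0$ for all $x,y,z\in\mathfrak{g}$. Let $\mathfrak{g}^2=[\mathfrak{g},\mathfrak{g}]$ and $\mathfrak{g}^3=[\mathfrak{g}^2,\mathfrak{g}]$ (linear spans). $\mathfrak{g}$ is $2$-step nilpotent if $\mathfrak{g}^3=0$ and $\mathfrak{g}^2\neq 0$; its type is $\dim\mathfrak{g}-\dim\mathfrak{g}^2$. $\mathfrak{g}$ is reduced if its center satisfies $Z(\mathfrak{g})\subseteq\mathfrak{g}^2$. Hyperbolic form: for a vector space $\mathfrak{v}$ and $\lambda=\pm1$, let $\varphi_{\mathfrak{v}}^\lambda$ be the form on $\mathfrak{v}\oplus\mathfrak{v}^*$ given by $\varphi_{\mathfrak{v}}^\lambda(v_1+f_1,v_2+f_2)=f_1(v_2)+\lambda f_2(v_1)$. A bilinear form is hyperbolic if it is isometric to some $\varphi_{\mathfrak{v}}^\lambda$. $d$-quadratic family: for $d\geq2$, an indexed family $\{A_1,\dots,A_d\}$ of $d\times d$ matrices over $\mathbb{K}$ is $d$-quadratic if: (1) every $A_i$ is skewsymmetric ($A_i^t=-A_i$); (2) the $i$-th column of $A_i$ is zero, for every $i$; (3) for all $j>i$, the $j$-th column of $A_i$ is the additive inverse of the $i$-th column of $A_j$; (4)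 if $B_{i<j}$ denotes the submatrix of $A_i$ formed by its columns $i+1,\dots,d$ (in order), then the $d\times\frac{d(d-1)}{2}$ matrix $B(A_1,\dots,A_d)=[B_{1<j}\,B_{2<j}\,\dots\,B_{d-1<j}]$ has rank $d$. *)

(* Defs.v *)
From mathcomp Require Import all_boot all_order all_algebra.

Set Implicit Arguments.
Unset Strict Implicit.
Unset Printing Implicit Defensive.

Import GRing.Theory.
Local Open Scope ring_scope.

Section LieAlgebra.
Variables (K : fieldType) (g : vectType K) (br : g -> g -> g).

Definition is_lie : Prop :=
  (forall x, br x x = 0) /\
  (forall x y z, br x (br y z) + br y (br z x) + br z (br x y) = 0).

(* The linear span of all br u v with u in U and v in V, for bilinear br: see
   [mem_brspace] and [brspace_min]. Same encoding as falgebra's [prodv]. *)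
Definition brspace (U V : {vspace g}) : {vspace g} :=
  <<allpairs br (vbasis U) (vbasis V)>>%VS.

Definition lie2 : {vspace g} := brspace fullv fullv.
Definition lie3 : {vspace g} := brspace lie2 fullv.

Definition two_step_nilpotent : Prop := lie3 = 0%VS /\ lie2 <> 0%VS.

(* The subtraction never truncates since [lie2] is a subspace of g. *)
Definition lie_type : nat := (\dim (fullv : {vspace g}) - \dim lie2)%N.

(* One-sided centralizing suffices: only used for Lie (antisymmetric) br. *)
Definition in_center (x : g) : Prop := forall y, br x y = 0.

Definition reduced : Prop := forall x, in_center x -> x \in lie2.

Variable phi : g -> g -> K.

Definition symmetric_bilin : Prop := forall x y, phi x y = phi y x.

Definition nondegenerate_bilin : Prop :=
  forall x, (forall y, phi x y = 0) -> x = 0.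

Definition invariant_bilin : Prop :=
  forall x y z, phi (br x y) z + phi y (br x z) = 0.

Definition is_quadratic : Prop :=
  [/\ symmetric_bilin, nondegenerate_bilin & invariant_bilin].

End LieAlgebra.

Section Brspace.
Variables (K : fieldType) (g : vectType K) (br : {bilinear g -> g -> g}).

Lemma mem_brspace (U V : {vspace g}) u v :
  u \in U -> v \in V -> br u v \in brspace br U V.
Proof.
move=> Uu Vv; rewrite (coord_vbasis Uu) (coord_vbasis Vv).
rewrite linear_sumlz; apply: memv_suml => i _.
rewrite linear_sumr; apply: memv_suml => j _.
rewrite linearZl_LR linearZr_LR !memvZ // memv_span //.
by apply: allpairs_f; rewrite memt_nth.
Qed.

Lemma brspace_min (U V W : {vspace g}) :
  (forall u v, u \in U -> v \in V -> br u v \in W) ->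
  (brspace br U V <= W)%VS.
Proof.
move=> UVW; apply/span_subvP => _ /allpairsP[[u v] /= [Uu Vv ->]].
by apply: UVW; apply: vbasis_mem.
Qed.

End Brspace.

Section Hyperbolic.
Variable K : fieldType.

Definition dual (V : vectType K) : vectType K := 'Hom(V, K^o).

Definition hyp_form (V : vectType K) (lambda : K) (x y : V * dual V) : K :=
  (x.2 : 'Hom(V, K^o)) y.1 + lambda * (y.2 : 'Hom(V, K^o)) x.1.

Definition hyperbolic (g : vectType K) (phi : g -> g -> K) : Prop :=
  exists (V : vectType K) (lambda : K) (f : {linear g -> (V * dual V)%type}),
    [/\ lambda = 1 \/ lambda = -1,
        bijective f &
        forall x y, phi x y = hyp_form lambda (f x) (f y)].

End Hyperbolic.

Definition gram_mx (K : fieldType) (g : vectType K) (phi : g -> g -> K)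
    (m : nat) (X : m.-tuple g) : 'M[K]_m :=
  \matrix_(i, j) phi (tnth X i) (tnth X j).

Section QuadraticFamily.
Variables (K : fieldType) (d : nat) (A : 'I_d -> 'M[K]_d).

Fact right_col_subproof (i : 'I_d) (l : 'I_(d - i.+1)) : (i.+1 + l < d)%N.
Proof. by rewrite -ltn_subRL. Qed.

Definition right_col (i : 'I_d) (l : 'I_(d - i.+1)) : 'I_d :=
  Ordinal (right_col_subproof l).

(* The columns of A_i strictly to the right of the i-th one. *)
Definition right_block (i : 'I_d) : 'M[K]_(d, d - i.+1) :=
  colsub (@right_col i) (A i).

(* Only the blocks of A_1, ..., A_(d-1) are concatenated. *)
Definition block_idx (i : 'I_d.-1) : 'I_d := widen_ord (leq_pred d) i.

Definition family_mx : 'M[K]_(d, \sum_(i < d.-1) (d - (block_idx i).+1)) :=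
  \mxrow_(i < d.-1) right_block (block_idx i).

Definition quadratic_family : Prop :=
  [/\ forall i, (A i)^T = - A i,
      forall i, col i (A i) = 0,
      forall i j : 'I_d, (i < j)%N -> col j (A i) = - col i (A j) &
      \rank family_mx = d].

Lemma family_mx_width :
  (\sum_(i < d.-1) (d - (block_idx i).+1) = (d * d.-1)./2)%N.
Proof.
rewrite -bin2 -bin2_sum /=.
case: d => [|m]; first by rewrite big_ord0 big_nil.
rewrite /= big_nat_recl // add0n big_mkord (reindex_inj rev_ord_inj) /=.
by apply: eq_bigr => i _; rewrite subSS subKn.
Qed.

End QuadraticFamily.

(* Main.v *)
(** In a quadratic Lie algebra the center is the orthogonal of [g^2]; if the
    algebra is moreover 2-step nilpotent and reduced, the center equals [g^2],
    so [g^2] is Lagrangian. Take a basis [z] of it; nondegeneracy gives a family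
    dual to [z], and subtracting suitable elements of [g^2] (2 is invertible)
    makes that family isotropic: this is [v]. In this basis the entry [(k, j)]
    of [A_i] is [phi [v_i, v_j] v_k], so alternation of the bracket and
    invariance of [phi] are the symmetry conditions on the family. The rank condition says
    that the products [v_i, v_j] span the [z_k], i.e. that no nonzero
    combination of the [v_k] is orthogonal to [g^2]. *)

From HB Require Import structures.
Require Import Defs.
From mathcomp Require Import all_boot all_order all_algebra.

Import GRing.Theory.
Local Open Scope ring_scope.

Set Implicit Arguments.
Unset Strict Implicit.
Unset Printing Implicit Defensive.

Lemma pchar0_two_neq0 (K : fieldType) : [pchar K] =i pred0 -> 2%:R != 0 :> K.
Proof. by move=> /pcharf0P ->. Qed.

Lemma sum_delta (K : nzRingType) (I : finType) (a : I -> K) j :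
  \sum_i a i * (i == j)%:R = a j.
Proof.
by rewrite (bigD1 j) //= eqxx mulr1 big1 ?addr0 // => i /negPf->; rewrite mulr0.
Qed.

(** * Columns of the concatenated matrix of a family *)

Section FamilyMatrix.
Variables (K : fieldType) (d : nat) (A : 'I_d -> 'M[K]_d).

Lemma family_mx_col c :
  exists i j : 'I_d, col c (family_mx A) = col j (A i).
Proof.
exists (block_idx (tagnat.sig1 c)), (right_col (tagnat.sig2 c)).
by rewrite col_mxrow; apply/colP => k; rewrite !mxE.
Qed.

(** For [i < j], column [j] of [A i] occurs in [family_mx A], as the column at offset [j - i.+1] of
    block [i]. *)
Lemma mul_family_mx_eq0 (r : 'rV[K]_d) (i j : 'I_d) :
  r *m family_mx A = 0 -> (i < j)%N -> r *m col j (A i) = 0.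
Proof.
move=> rF0 ltij.
(* The last index has no block; having [j] above it keeps [i] among the first [d.-1] indices. *)
have lti : (i < d.-1)%N.
  by rewrite -ltnS prednK ?(leq_ltn_trans _ (ltn_ord j)) //
     (leq_ltn_trans ltij).
have ei : i = block_idx (Ordinal lti) by apply: val_inj.
have ltl : (j - i.+1 < d - (block_idx (Ordinal lti)).+1)%N.
  by rewrite ltn_sub2r // (leq_ltn_trans ltij).
have ej : j = right_col (Ordinal ltl) by apply: val_inj; rewrite /= subnKC.
have rB0 : r *m right_block A (block_idx (Ordinal lti)) = 0.
  move: rF0; rewrite /family_mx mul_mxrow => /mxrowP/(_ (Ordinal lti)).
  by rewrite mxrowK => ->; apply/matrixP => a b; rewrite !mxE.
move/matrixP: rB0 => /(_ 0 (Ordinal ltl)); rewrite !mxE => rB0.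
apply/matrixP => a b; rewrite ord1 mxE [RHS]mxE -{}[RHS]rB0.
by apply: eq_bigr => k _; rewrite !mxE -ej -ei.
Qed.

End FamilyMatrix.

(** * Hyperbolic pairs, their coordinates and the hyperbolic form *)

Section HyperbolicPair.
Variables (K : fieldType) (g : vectType K).
Variable phi : {bilinear g -> g -> K | *%R & *%R}.

Lemma form_suml (I : finType) (a : I -> K) (u : I -> g) y :
  phi (\sum_i a i *: u i) y = \sum_i a i * phi (u i) y.
Proof. by rewrite linear_sumlz; apply: eq_bigr => i _; rewrite linearZl_LR. Qed.

Lemma form_sumr (I : finType) (a : I -> K) (u : I -> g) x :
  phi x (\sum_i a i *: u i) = \sum_i a i * phi x (u i).
Proof. by rewrite linear_sumr; apply: eq_bigr => i _; rewrite linearZr_LR. Qed.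

(** Pair a basis of [g] with [z]: a relation between the columns of this matrix is a combination of
    [z] orthogonal to everything, hence trivial. The matrix thus has a left inverse, whose rows are
    the coordinates of the [u i]. *)
Lemma nondegenerate_dual_family (m : nat) (z : m.-tuple g) :
  symmetric_bilin phi -> nondegenerate_bilin phi -> free z ->
  exists u : 'I_m -> g, forall i j, phi (u i) (tnth z j) = (i == j)%:R.
Proof.
move=> symphi ndphi /freeP freez.
pose e := vbasis (fullv : {vspace g}).
pose M := \matrix_(i, j) phi (tnth e i) (tnth z j) : 'M[K]_(_, m).
have fullM : row_full M.
  rewrite /row_full -mxrank_tr -/(row_free M^T) -kermx_eq0.
  apply/rowV0P => r /sub_kermxP rM0.
  suff r0 : \sum_i r 0 i *: z`_i = 0.
    by apply/rowP => i; rewrite mxE; exact: freez r0 i.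
  apply: ndphi => y; rewrite (coord_vbasis (memvf y)) form_sumr.
  apply: big1 => i _; rewrite (_ : phi _ _ = 0) ?mulr0 //.
  move/rowP: rM0 => /(_ i); rewrite !mxE => rM0.
  rewrite form_suml -[RHS]rM0; apply: eq_bigr => j _.
  by rewrite !mxE symphi !(tnth_nth 0).
have /row_fullP[G GM1] := fullM.
exists (fun i => \sum_k G i k *: tnth e k) => i j.
move/matrixP: GM1 => /(_ i j); rewrite !mxE form_suml => <-.
by apply: eq_bigr => k _; rewrite !mxE.
Qed.

(** Both mixed pairings are recorded because symmetry of [phi] is not assumed: [pair_symmetric]
    deduces it from the expansion. *)
Definition hyperbolic_pair d (v z : 'I_d -> g) : Prop :=
  [/\ forall i j, phi (v i) (v j) = 0, forall i j, phi (z i) (z j) = 0,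
      forall i j, phi (v i) (z j) = (i == j)%:R &
      forall i j, phi (z i) (v j) = (i == j)%:R].

Variables (d : nat) (v z : d.-tuple g).

Lemma gram_mx_catE :
  gram_mx phi (cat_tuple v z) = block_mx 0 1%:M 1%:M 0 <->
  hyperbolic_pair (tnth v) (tnth z).
Proof.
split=> [/matrixP gram | [vv zz vz zv]].
  split=> i j.
  - by have := gram (lshift d i) (lshift d j);
      rewrite mxE block_mxEul !mxE !tnth_lshift.
  - by have := gram (rshift d i) (rshift d j);
      rewrite mxE block_mxEdr !mxE !tnth_rshift.
  - by have := gram (lshift d i) (rshift d j);
      rewrite mxE block_mxEur !mxE tnth_lshift tnth_rshift.
  - by have := gram (rshift d i) (lshift d j);
      rewrite mxE block_mxEdl !mxE tnth_lshift tnth_rshift.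
apply/matrixP => i j; rewrite mxE.
case: (splitP i) => k; rewrite -[k : nat]/(nat_of_ord (lshift d k));
  [|rewrite -[(d + k)%N]/(nat_of_ord (rshift d k))]; move=> /val_inj ->;
  case: (splitP j) => l; rewrite -?[l : nat]/(nat_of_ord (lshift d l))
   -?[(d + l)%N]/(nat_of_ord (rshift d l)) => /val_inj ->;
  by rewrite ?block_mxEul ?block_mxEur ?block_mxEdl ?block_mxEdr
       ?tnth_lshift ?tnth_rshift !mxE.
Qed.

Hypothesis vz_pair : hyperbolic_pair (tnth v) (tnth z).

Let vv i j : phi (tnth v i) (tnth v j) = 0. Proof. by case: vz_pair. Qed.
Let zz i j : phi (tnth z i) (tnth z j) = 0. Proof. by case: vz_pair. Qed.
Let vz i j : phi (tnth v i) (tnth z j) = (i == j)%:R.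
Proof. by case: vz_pair. Qed.
Let zv i j : phi (tnth z i) (tnth v j) = (i == j)%:R.
Proof. by case: vz_pair. Qed.

Definition pair_comb (a b : 'I_d -> K) : g :=
  \sum_i a i *: tnth v i + \sum_i b i *: tnth z i.

Lemma form_pair_combv a b j : phi (pair_comb a b) (tnth v j) = b j.
Proof.
rewrite linearDl !form_suml big1 => [|i _]; last by rewrite vv mulr0.
by rewrite add0r; under eq_bigr do rewrite zv; rewrite sum_delta.
Qed.

Lemma form_pair_combz a b j : phi (pair_comb a b) (tnth z j) = a j.
Proof.
rewrite linearDl !form_suml [X in _ + X]big1 => [|i _].
  by rewrite addr0; under eq_bigr do rewrite vz; rewrite sum_delta.
by rewrite zz mulr0.
Qed.

Lemma sum_nth_cat (c : 'I_(d + d) -> K) :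
  \sum_i c i *: (cat_tuple v z)`_i
  = pair_comb (c \o @lshift d d) (c \o @rshift d d).
Proof.
rewrite /pair_comb big_split_ord /=; congr (_ + _); apply: eq_bigr => i _.
  by rewrite -(tnth_lshift v z) (tnth_nth 0).
by rewrite -(tnth_rshift v z) (tnth_nth 0).
Qed.

(** Pairing a combination with [z] and with [v] recovers its coefficients. *)
Lemma pair_free : free (cat_tuple v z).
Proof.
apply/freeP => c; rewrite sum_nth_cat => c0 i.
have [j ->|j ->] := split_ordP i.
  by rewrite -[LHS](form_pair_combz (c \o @lshift d d) (c \o @rshift d d))
             c0 linear0l.
by rewrite -[LHS](form_pair_combv (c \o @lshift d d) (c \o @rshift d d))
             c0 linear0l.
Qed.

(** For a hyperbolic pair this amounts to spanning the whole space, with coordinates given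
    explicitly by [phi]. *)
Definition pair_expansion : Prop := forall x, x =
  pair_comb (fun i => phi x (tnth z i)) (fun i => phi x (tnth v i)).

Lemma basis_pair_expansion :
  basis_of fullv (cat_tuple v z) -> pair_expansion.
Proof.
move=> basX x.
have := coord_basis basX (memvf x); rewrite sum_nth_cat.
move: (_ \o _) (_ \o _) => a b xE.
rewrite {1}xE; congr (_ + _); apply: eq_bigr => i _; congr (_ *: _).
  by rewrite xE form_pair_combz.
by rewrite xE form_pair_combv.
Qed.

Lemma pair_expansion_basis :
  pair_expansion -> basis_of fullv (cat_tuple v z).
Proof.
move=> expx; rewrite /basis_of pair_free andbT eqEsubv subvf /=.
apply/subvP => x _; rewrite (expx x).
by rewrite memvD //; apply: memv_suml => i _;
  rewrite memvZ // memv_span // mem_cat mem_tnth ?orbT.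
Qed.

Definition row_eval (b : 'I_d -> K) (r : 'rV[K]_d) : K^o :=
  \sum_i b i * r 0 i.

Fact row_eval_is_linear b : linear (row_eval b).
Proof.
move=> a r s; rewrite /row_eval scaler_sumr -big_split /=.
by apply: eq_bigr => i _; rewrite !mxE mulrDr mulrCA.
Qed.

HB.instance Definition _ b :=
  GRing.isLinear.Build K 'rV[K]_d K^o _ (row_eval b) (row_eval_is_linear b).

(** The isometry onto the hyperbolic space: the span of [v] becomes the row space, and [phi] turns
    the span of [z] into its dual. *)
Definition pair_split (x : g) : 'rV[K]_d * dual 'rV[K]_d :=
  (\row_i phi x (tnth z i), linfun (row_eval (fun i => phi x (tnth v i)))).

Fact pair_split_is_linear : linear pair_split.
Proof.
move=> a x y; rewrite /pair_split; congr (_, _).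
  by apply/rowP => i; rewrite !mxE linearDl linearZl_LR.
apply/lfunP => r; rewrite !lfun_simp /= /row_eval scaler_sumr -big_split /=.
by apply: eq_bigr => i _; rewrite linearDl linearZl_LR mulrDl -mulrA.
Qed.

HB.instance Definition _ :=
  GRing.isLinear.Build K g ('rV[K]_d * dual 'rV[K]_d)%type _ pair_split
    pair_split_is_linear.

Hypothesis expx : pair_expansion.

Lemma form_expand x y :
  phi x y = \sum_i phi x (tnth v i) * phi y (tnth z i)
            + \sum_i phi y (tnth v i) * phi x (tnth z i).
Proof.
rewrite {1}(expx y) linearDr !form_sumr; congr (_ + _).
by apply: eq_bigr => i _; rewrite mulrC.
Qed.

Lemma pair_symmetric : symmetric_bilin phi.
Proof. by move=> x y; rewrite form_expand addrC -form_expand. Qed.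

Lemma pair_nondegenerate : nondegenerate_bilin phi.
Proof.
move=> x x0; rewrite (expx x) /pair_comb !big1 ?addr0 // => i _.
  by rewrite x0 scale0r.
by rewrite x0 scale0r.
Qed.

Lemma pair_hyperbolic : hyperbolic phi.
Proof.
exists 'rV[K]_d, 1, pair_split; split; first by left.
  (* The inverse reads the [z]-coordinates of a functional off its values on the canonical basis. *)
  exists (fun p : 'rV[K]_d * dual 'rV[K]_d => pair_comb (fun i => p.1 0 i)
    (fun i => (p.2 : 'Hom('rV[K]_d, K^o)) (delta_mx 0 i))) => [x | [r h]] /=.
    rewrite [RHS]expx; congr (_ + _); apply: eq_bigr => i _; congr (_ *: _).
      by rewrite mxE.
    rewrite lfunE /= /row_eval -[RHS](sum_delta (fun j => phi x (tnth v j))).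
    by apply: eq_bigr => j _; rewrite mxE eqxx.
  congr (_, _); first by apply/rowP => i; rewrite mxE form_pair_combz.
  apply/lfunP => s; rewrite lfunE /= /row_eval {2}(row_sum_delta s) linear_sum.
  by apply: eq_bigr => i _; rewrite form_pair_combv linearZ mulrC.
move=> x y; rewrite form_expand /hyp_form /= !lfunE /= mul1r.
by congr (_ + _); apply: eq_bigr => i _; rewrite mxE.
Qed.

End HyperbolicPair.

(** * Isotropic complements of Lagrangian subspaces *)

Section Lagrangian.
Variables (K : fieldType) (g : vectType K).
Variable phi : {bilinear g -> g -> K | *%R & *%R}.

Lemma lagrangian_hyperbolic_pair (W : {vspace g}) :
    2%:R != 0 :> K -> symmetric_bilin phi -> nondegenerate_bilin phi ->
    (forall x, x \in W <-> forall y, y \in W -> phi x y = 0) ->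
  exists v z : (\dim W).-tuple g,
    [/\ basis_of W z, hyperbolic_pair phi (tnth v) (tnth z) &
        pair_expansion phi v z].
Proof.
move=> nz2 symphi ndphi lagW.
pose z := vbasis W; have basz : basis_of W z := vbasisP W.
have Wz i : tnth z i \in W by rewrite vbasis_mem // mem_tnth.
have zz i j : phi (tnth z i) (tnth z j) = 0 by apply: (lagW _).1.
have [u uz] := nondegenerate_dual_family symphi ndphi (basis_free basz).
(* The choice of u is unique up to W, which leaves room to make it isotropic. *)
pose v := [tuple u i - \sum_j (2%:R^-1 * phi (u i) (u j)) *: tnth z j
          | i < \dim W].
have vE i : tnth v i = u i - \sum_j (2%:R^-1 * phi (u i) (u j)) *: tnth z j.
  by rewrite tnth_mktuple.
have vz i j : phi (tnth v i) (tnth z j) = (i == j)%:R.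
  rewrite vE linearBl form_suml uz big1 ?subr0 // => k _.
  by rewrite zz mulr0.
have zv i j : phi (tnth z i) (tnth v j) = (i == j)%:R.
  by rewrite symphi vz eq_sym.
have vv i j : phi (tnth v i) (tnth v j) = 0.
  rewrite {1}vE linearBl form_suml.
  under eq_bigr do rewrite zv.
  rewrite sum_delta vE linearBr form_sumr.
  under eq_bigr do rewrite uz eq_sym.
  (* The two corrections each subtract half of [phi (u i) (u j)]. *)
  rewrite sum_delta (symphi (u j)) -addrA -opprD -mulrDl -mulr2n.
  by rewrite -[2%:R^-1 *+ 2]mulr_natr mulVf // mul1r subrr.
have vzP : hyperbolic_pair phi (tnth v) (tnth z) by split.
exists v, z; split=> // x.
(* The remainder [x - y] is orthogonal to [z], so it lies in [W]; its coordinates there are its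
   pairings with [v], which also vanish. *)
set y := pair_comb _ _ _ _; apply/eqP; rewrite -subr_eq0; apply/eqP.
have yz i : phi (x - y) (tnth z i) = 0.
  by rewrite linearBl form_pair_combz // subrr.
have yv i : phi (x - y) (tnth v i) = 0.
  by rewrite linearBl form_pair_combv // subrr.
have Wxy : x - y \in W.
  apply/lagW => w Ww; rewrite (coord_basis basz Ww) form_sumr big1 // => i _.
  by rewrite -tnth_nth yz mulr0.
rewrite (coord_basis basz Wxy) big1 // => i _.
suff -> : coord z i (x - y) = phi (x - y) (tnth v i) by rewrite yv scale0r.
rewrite [in RHS](coord_basis basz Wxy) form_suml.
rewrite -[LHS](sum_delta (fun j => coord z j (x - y))).
by apply: eq_bigr => j _; rewrite -tnth_nth zv.
Qed.

End Lagrangian.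

(** * Brackets and invariant forms *)

Section LieForm.
Variables (K : fieldType) (g : vectType K) (br : {bilinear g -> g -> g}).
Variable phi : {bilinear g -> g -> K | *%R & *%R}.

Lemma alternating_antisym :
  (forall x, br x x = 0) -> forall x y, br x y = - br y x.
Proof.
move=> alt x y; apply/eqP; rewrite -addr_eq0.
have := alt (x + y); rewrite linearDl !linearDr !alt add0r addr0 => ->.
by [].
Qed.

Lemma lie2_orth x : (forall u w, phi x (br u w) = 0) ->
  forall y, y \in lie2 br -> phi x y = 0.
Proof.
move=> x0 y /(coord_span (X := in_tuple _)) ->.
rewrite form_sumr big1 // => i _; rewrite -tnth_nth.
by have /allpairsP[[u w] [_ _ ->]] := mem_tnth i (in_tuple _); rewrite x0 mulr0.
Qed.

(** Invariance gives [phi (br u x) w = - phi x (br u w)]; nondegeneracy turns vanishing for all [w]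
    into [br u x = 0]. *)
Lemma in_center_orth x : is_lie br -> is_quadratic br phi ->
  in_center br x <-> forall y, y \in lie2 br -> phi x y = 0.
Proof.
case=> /alternating_antisym anti _ [symphi ndphi invphi]; split=> [cx | x0 y].
  apply: lie2_orth => u w.
  by rewrite -[RHS](invphi u x w) (anti u x) cx oppr0 linear0l add0r.
rewrite anti (ndphi (br y x)) ?oppr0 // => w.
by rewrite -[RHS](invphi y x w) x0 ?addr0 // mem_brspace ?memvf.
Qed.

Lemma lie2_lagrangian : is_lie br -> is_quadratic br phi ->
    lie3 br = 0%VS -> reduced br ->
  forall x, x \in lie2 br <-> forall y, y \in lie2 br -> phi x y = 0.
Proof.
move=> lie quad l30 red x; split=> [l2x|].
  apply/(in_center_orth x lie quad) => y.
  by apply/eqP; rewrite -memv0 -l30 mem_brspace ?memvf.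
by move/(in_center_orth x lie quad)/red.
Qed.

(** * The bracket in a hyperbolic basis with central [z] *)

Variables (d : nat) (v z : d.-tuple g).
Hypothesis vzP : hyperbolic_pair phi (tnth v) (tnth z).
Hypothesis expx : pair_expansion phi v z.
Hypothesis zcenter : forall i x, br (tnth z i) x = 0 /\ br x (tnth z i) = 0.

Lemma br_expand x y : br x y =
  \sum_i \sum_j
    (phi x (tnth z i) * phi y (tnth z j)) *: br (tnth v i) (tnth v j).
Proof.
rewrite {1}(expx x) linearDl !linear_sumlz [X in _ + X]big1 => [|i _];
    last first.
  by rewrite linearZl_LR (zcenter _ _).1 scaler0.
rewrite addr0; apply: eq_bigr => i _.
rewrite linearZl_LR {1}(expx y) linearDr !linear_sumr.
rewrite [X in _ + X]big1 => [|j _];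
    last first.
  by rewrite linearZr_LR (zcenter _ _).2 scaler0.
rewrite addr0 scaler_sumr; apply: eq_bigr => j _.
by rewrite linearZr_LR scalerA.
Qed.

Lemma lagrangian_quadratic_family :
    is_lie br -> is_quadratic br phi -> lie3 br = 0%VS -> reduced br ->
    (forall i, tnth z i \in lie2 br) ->
  quadratic_family (fun i =>
    \matrix_(k, j) phi (br (tnth v i) (tnth v j)) (tnth v k)).
Proof.
move=> lie quad l30 red l2z.
have [alt _] := lie; have anti := alternating_antisym alt.
have [symphi ndphi invphi] := quad.
set A := fun i => _.
have Aii i : col i (A i) = 0.
  by apply/colP => k; rewrite !mxE alt linear0l.
have Aij i j : col j (A i) = - col i (A j).
  by apply/colP => k; rewrite !mxE anti linearNl.
split=> //.
  move=> i; apply/matrixP => k j; rewrite !mxE; apply/eqP; rewrite -addr_eq0.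
  (* Skewsymmetry of [A i] is invariance of [phi] under bracketing with [v_i]. *)
  by rewrite (symphi _ (tnth v k)) invphi.
apply/eqP; change (row_free (family_mx A)).
rewrite -kermx_eq0; apply/rowV0P => r /sub_kermxP rF0.
(* Antisymmetry in [i] and [j] extends the vanishing to the columns left out of [family_mx A]. *)
have rA i j : r *m col j (A i) = 0.
  have [ltij|ltji|/val_inj <-] := ltngtP i j.
  - exact: mul_family_mx_eq0.
  - by rewrite Aij mulmxN mul_family_mx_eq0 // oppr0.
  - by rewrite Aii mulmx0.
(* This [w] is orthogonal to all brackets, hence lies in [lie2 br], which is isotropic and contains
   [z]; so the entries [phi w z_k] of [r] vanish. *)
pose w := pair_comb v z (fun i => r 0 i) (fun=> 0).
have wE : w = \sum_i r 0 i *: tnth v i.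
  by rewrite /w /pair_comb [X in _ + X]big1 ?addr0 // => i _; rewrite scale0r.
have wv i j : phi w (br (tnth v i) (tnth v j)) = 0.
  have /matrixP/(_ 0 0) := rA i j; rewrite !mxE => rA0.
  rewrite wE form_suml -[RHS]rA0; apply: eq_bigr => k _.
  by rewrite !mxE symphi.
have l2w : w \in lie2 br.
  apply/(lie2_lagrangian lie quad l30 red); apply: lie2_orth => x y.
  rewrite br_expand linear_sumr big1 // => i _.
  rewrite linear_sumr big1 // => j _.
  by rewrite linearZr_LR wv mulr0.
apply/rowP => k; rewrite mxE.
rewrite -[LHS](form_pair_combz vzP (fun i => r 0 i) (fun=> 0)).
exact: (lie2_lagrangian lie quad l30 red w).1 l2w _ (l2z k).
Qed.

(** * From a quadratic family to the algebra *)

Variable A : 'I_d -> 'M[K]_d.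
Hypothesis brv : forall i j,
  br (tnth v i) (tnth v j) = \sum_(k < d) A i k j *: tnth z k.

Lemma form_br x y w : phi (br x y) w =
  \sum_i \sum_j \sum_k
    phi x (tnth z i) * phi y (tnth z j) * phi w (tnth z k) * A i k j.
Proof.
have zw k : phi (tnth z k) w = phi w (tnth z k).
  by rewrite (pair_symmetric expx).
rewrite br_expand linear_sumlz; apply: eq_bigr => i _.
rewrite linear_sumlz; apply: eq_bigr => j _.
rewrite linearZl_LR brv form_suml mulr_sumr; apply: eq_bigr => k _.
by rewrite zw -!mulrA; do 2 congr (_ * _); rewrite mulrC.
Qed.

Hypothesis famA : quadratic_family A.

Lemma family_antisym i j :
  br (tnth v i) (tnth v j) = - br (tnth v j) (tnth v i).
Proof.
have [_ Aii Aij _] := famA.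
have Aanti : col j (A i) = - col i (A j).
  have [ltij|ltji|/val_inj <-] := ltngtP i j.
  - exact: Aij.
  - by rewrite (Aij j i) // opprK.
  - by rewrite Aii oppr0.
rewrite !brv -sumrN; apply: eq_bigr => k _.
by move/colP: Aanti => /(_ k); rewrite !mxE => ->; rewrite scaleNr.
Qed.

Lemma family_is_lie : 2%:R != 0 :> K -> is_lie br.
Proof.
move=> nz2; split=> [x | x y w].
  (* Exchanging the two summation indices reverses the sign; invertibility of 2 then gives
     alternation. *)
  have : br x x = - br x x.
    rewrite {1}br_expand exchange_big br_expand -sumrN; apply: eq_bigr => i _.
    rewrite -sumrN; apply: eq_bigr => j _.
    by rewrite family_antisym scalerN mulrC.
  move/eqP; rewrite -addr_eq0 -mulr2n -scaler_nat scaler_eq0 (negPf nz2).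
  by move/eqP.
(* Brackets lie in the span of the central [z], so each Jacobi term vanishes separately. *)
have br0 a b c : br a (br b c) = 0.
  rewrite (br_expand b c) linear_sumr big1 // => i _.
  rewrite linear_sumr big1 // => j _.
  rewrite linearZr_LR brv linear_sumr big1 ?scaler0 // => k _.
  by rewrite linearZr_LR (zcenter _ _).2 scaler0.
by rewrite !br0 !addr0.
Qed.

Lemma family_is_quadratic : is_quadratic br phi.
Proof.
have symphi := pair_symmetric expx.
have [Askew _ _ _] := famA.
split=> //; first exact: (pair_nondegenerate expx).
move=> x y w; rewrite (symphi y) !form_br -big_split big1 //= => i _.
(* Swapping [j] and [k] in the second sum aligns the coordinates; the terms then cancel by
   skewsymmetry of [A i]. *)
rewrite [X in _ + X]exchange_big -big_split big1 //= => j _.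
rewrite -big_split big1 //= => k _.
have -> : A i k j = - A i j k.
  by move/matrixP: (Askew i) => /(_ j k); rewrite !mxE.
by rewrite mulrN (mulrAC (phi x _) (phi w _)) addNr.
Qed.

Lemma family_lie2 : lie2 br = <<z>>%VS.
Proof.
apply/eqP; rewrite eqEsubv; apply/andP; split.
  apply: brspace_min => x y _ _; rewrite br_expand.
  apply: memv_suml => i _; apply: memv_suml => j _; rewrite memvZ // brv.
  by apply: memv_suml => k _; rewrite memvZ // memv_span // mem_tnth.
apply/span_subvP => _ /tnthP[k ->].
have [_ _ _ /eqP rkF] := famA.
(* Rank [d] provides a right inverse [G]. Its column [k] writes [z_k] as a combination of the
   columns of [family_mx A], each of which is the coordinate vector of some [[v_i, v_j]]. *)
have /row_freeP[G FG1] : row_free (family_mx A) by [].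
have -> : tnth z k = \sum_c G c k *: \sum_j family_mx A j c *: tnth z j.
  under eq_bigr do rewrite scaler_sumr.
  rewrite exchange_big /= (bigD1 k) //= [X in _ + X]big1 => [|j neqjk].
    rewrite addr0; under eq_bigr do rewrite scalerA mulrC.
    rewrite -scaler_suml; move/matrixP: FG1 => /(_ k k).
    by rewrite !mxE eqxx => ->; rewrite scale1r.
  under eq_bigr do rewrite scalerA mulrC.
  rewrite -scaler_suml; move/matrixP: FG1 => /(_ j k).
  by rewrite !mxE (negPf neqjk) => ->; rewrite scale0r.
apply: memv_suml => c _; rewrite memvZ //.
have [i [j /colP Fc]] := family_mx_col A c.
rewrite (_ : \sum_l _ = br (tnth v i) (tnth v j)) ?mem_brspace ?memvf // brv.
by apply: eq_bigr => l _; move: (Fc l); rewrite !mxE => ->.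
Qed.

Lemma family_lie3 : lie3 br = 0%VS.
Proof.
apply/eqP; rewrite -subv0; apply: brspace_min => x y.
rewrite family_lie2 => /coord_span -> _; rewrite linear_sumlz.
apply: memv_suml => i _.
by rewrite linearZl_LR -tnth_nth (zcenter _ _).1 scaler0 mem0v.
Qed.

(** A central element is orthogonal to the span of [z], so its [v]-coordinates vanish. *)
Lemma family_reduced : 2%:R != 0 :> K -> reduced br.
Proof.
move=> nz2 x /(in_center_orth x (family_is_lie nz2) family_is_quadratic) x0.
rewrite family_lie2 in x0 *; rewrite (expx x) memvD //; apply: memv_suml => i _.
  by rewrite x0 ?scale0r ?mem0v // memv_span // mem_tnth.
by rewrite memvZ // memv_span // mem_tnth.
Qed.

End LieForm.

Theorem theorem8 (K : fieldType) (charK0 : [pchar K] =i pred0)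
    (d : nat) (d_ge2 : (2 <= d)%N) (n : vectType K)
    (br : {bilinear n -> n -> n})
    (phi : {bilinear n -> n -> K | *%R & *%R}) :
  [/\ is_lie br, is_quadratic br phi, two_step_nilpotent br,
      lie_type br = d & reduced br]
  <->
  (exists (v z : d.-tuple n) (A : 'I_d -> 'M[K]_d),
     [/\ basis_of (fullv : {vspace n}) (cat_tuple v z),
         quadratic_family A,
         forall (i : 'I_d) (x : n),
           br (tnth z i) x = 0 /\ br x (tnth z i) = 0,
         forall i j : 'I_d,
           br (tnth v i) (tnth v j) = \sum_(k < d) A i k j *: tnth z k &
         hyperbolic phi /\
         gram_mx phi (cat_tuple v z) = block_mx 0 1%:M 1%:M 0]).
Proof.
have nz2 := pchar0_two_neq0 charK0.
split=> [[lie quad [l30 _] typ red] | [v [z [A [basX famA zc brv [_ gram]]]]]].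
  have [symphi ndphi _] := quad.
  have lag := lie2_lagrangian lie quad l30 red.
  have [v [z [basz vzP expx]]] :=
    lagrangian_hyperbolic_pair nz2 symphi ndphi lag.
  have basX := pair_expansion_basis vzP expx.
  (* The basis shows that [n] has twice the dimension of [lie2 br], so the type equals
     [\dim (lie2 br)]. *)
  have l2d : \dim (lie2 br) = d.
    by rewrite -typ /lie_type (size_basis basX) addnK.
  (* With [typ] gone, [l2d] is what replaces [d] by [\dim (lie2 br)], the length of the tuples [v]
     and [z]. *)
  clear typ; subst d.
  have l2z i : tnth z i \in lie2 br by apply: (basis_mem basz); apply: mem_tnth.
  have zc i x : br (tnth z i) x = 0 /\ br x (tnth z i) = 0.
    have zx0 : br (tnth z i) x = 0.
      by apply/eqP; rewrite -memv0 -l30 mem_brspace ?memvf.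
    by split=> //; rewrite (alternating_antisym lie.1) zx0 oppr0.
  exists v, z, (fun i =>
    \matrix_(k, j) phi (br (tnth v i) (tnth v j)) (tnth v k)).
  split=> //; first exact: (lagrangian_quadratic_family vzP expx zc).
    (* The [v]-part of a bracket vanishes since [lie2 br] is isotropic; its [z]-coordinates are the
       chosen matrix entries. *)
    move=> i j; rewrite [LHS]expx /pair_comb big1 ?add0r => [|k _].
      by apply: eq_bigr => k _; rewrite mxE.
    by rewrite (lag _).1 ?scale0r // mem_brspace ?memvf.
  split; first exact: (pair_hyperbolic vzP expx).
  exact/gram_mx_catE.
have vzP := (gram_mx_catE phi v z).1 gram.
have expx := basis_pair_expansion vzP basX.
have freez : free z by apply: catr_free (basis_free basX).
have l2E := family_lie2 expx zc brv famA.
have l2d : \dim (lie2 br) = d.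
  by rewrite l2E; apply/eqP; rewrite -[X in _ == X](size_tuple z).
split.
- exact: family_is_lie famA nz2.
- exact: family_is_quadratic famA.
- split; first exact: family_lie3 famA.
  (* A zero derived algebra would force [d = 0]. *)
  by move=> l20; move: d_ge2; rewrite -l2d l20 dimv0.
- by rewrite /lie_type l2d (size_basis basX) addnK.
- exact: family_reduced famA nz2.
Qed.
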